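(* Let $n \in \mathbb{N}$ with $n > 1$ composite. Then $$T(n) := \gcd\left( \frac{n}{\chi(n)},\ \left\lfloor \sqrt[\omega(n)]{n} \right\rfloor ! \right)$$ is a non-trivial divisor of $n$, i.e. $T(n) \mid n$ and $1 < T(n) < n$.
   Context: For $n \geq 1$, $\chi(n) = \max\{ s \in \mathbb{N} : s^2 \mid n \}$ and $\omega(n)$ is the number of distinct primes dividing $n$. $\lfloor \sqrt[m]{n} \rfloor$ denotes the largest natural number $r$ with $r^m \leq n$. *)

(* Defs.v *)
From mathcomp Require Import all_boot.

Set Implicit Arguments.
Unset Strict Implicit.
Unset Printing Implicit Defensive.

(* Largest s with s ^ 2 %| n. For n > 0 every such s is at most n, so the
   search bound loses nothing (see chi_max). *)
Definition chi (n : nat) : nat := \max_(s < n.+1 | s ^ 2 %| n) s.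

Definition omega (n : nat) : nat := size (primes n).

(* Largest r with r ^ m <= n. For m > 0 every such r is at most n, so the
   search bound loses nothing (see floor_root_max); for m = 0 there is no
   meaningful value. *)
Definition floor_root (m n : nat) : nat := \max_(r < n.+1 | r ^ m <= n) r.

Definition composite (n : nat) : bool := (1 < n) && ~~ prime n.

(* The quotient is exact, since chi n ^ 2 %| n. *)
Definition T (n : nat) : nat :=
  gcdn (n %/ chi n) (floor_root (omega n) n)`!.

Lemma chi_sqr_dvd (n : nat) : 0 < n -> chi n ^ 2 %| n.
Proof.
move=> n_gt0; have P1 : (Ordinal (n_gt0 : 1 < n.+1)) ^ 2 %| n by rewrite dvd1n.
by rewrite /chi (bigmax_eq_arg _ P1); case: arg_maxnP.
Qed.

Lemma chi_max (n s : nat) : 0 < n -> s ^ 2 %| n -> s <= chi n.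
Proof.
move=> n_gt0 sn; have s_le : s < n.+1.
  by rewrite ltnS dvdn_leq // (dvdn_trans _ sn) // dvdn_exp.
exact: (@leq_bigmax_cond _ _ (fun i : 'I_n.+1 => i : nat) (Ordinal s_le)).
Qed.

Lemma floor_root_exp_le (m n : nat) : 0 < m -> floor_root m n ^ m <= n.
Proof.
move=> m_gt0; have P0 : (ord0 : 'I_n.+1) ^ m <= n by rewrite exp0n.
by rewrite /floor_root (bigmax_eq_arg _ P0); case: arg_maxnP.
Qed.

Lemma floor_root_max (m n r : nat) :
  0 < m -> r ^ m <= n -> r <= floor_root m n.
Proof.
move=> m_gt0 rn; have r_le : r < n.+1.
  rewrite ltnS (leq_trans _ rn) //; case: r {rn} => // r.
  by rewrite -{1}[r.+1]expn1 leq_pexp2l.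
exact: (@leq_bigmax_cond _ _ (fun i : 'I_n.+1 => i : nat) (Ordinal r_le)).
Qed.

(* Main.v *)
(** The least prime factor [p] of [n] satisfies [p ^ omega n <= n], so it divides
    the factorial, and it divides [n / chi n] because [chi n ^ 2] divides [n].
    If [T n = n], then [chi n = 1], so [n] is squarefree, and every prime factor
    of [n] is at most the root [r]; as [n] is the product of at least two distinct
    such primes, [n < r ^ omega n], contradicting the choice of [r]. *)
Require Import Defs.
From mathcomp Require Import all_boot.

Lemma prod_primes_logn (n : nat) :
  0 < n -> \prod_(p <- primes n) p ^ logn p n = n.
Proof. by move=> n0; rewrite [RHS]prod_prime_decomp // prime_decompE big_map. Qed.

Lemma prod_seq_ge_exp (r : nat) (s : seq nat) :
  (forall p, p \in s -> r <= p) -> r ^ size s <= \prod_(p <- s) p.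
Proof.
elim: s => [|x s IHs] hs; first by rewrite big_nil.
rewrite big_cons expnS leq_mul ?hs ?mem_head // IHs // => p ps.
by rewrite hs // inE ps orbT.
Qed.

Lemma prod_seq_le_exp (r : nat) (s : seq nat) :
  (forall p, p \in s -> p <= r) -> \prod_(p <- s) p <= r ^ size s.
Proof.
elim: s => [|x s IHs] hs; first by rewrite big_nil.
rewrite big_cons expnS leq_mul ?hs ?mem_head // IHs // => p ps.
by rewrite hs // inE ps orbT.
Qed.

(** This supplies the positive root index that [floor_root_max] and [floor_root_exp_le] require. *)
Lemma omega_gt0 {n : nat} : 1 < n -> 0 < omega n.
Proof.
move=> n1; have : pdiv n \in primes n.
  by rewrite mem_primes pdiv_prime // pdiv_dvd (ltnW n1).
by rewrite /omega; case: (primes n).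
Qed.

(** Lower every exponent in the factorization of [n] to 1, then replace each of the [omega n] primes
    by the least one. *)
Lemma pdiv_exp_omega_le (n : nat) : 0 < n -> pdiv n ^ omega n <= n.
Proof.
move=> n0; rewrite -[leqRHS]prod_primes_logn //.
apply: (@leq_trans (\prod_(p <- primes n) p)).
  apply: prod_seq_ge_exp => p; rewrite mem_primes => /and3P[pp _ pn].
  by rewrite pdiv_min_dvd ?prime_gt1.
rewrite [leqLHS]big_seq [leqRHS]big_seq; apply: leq_prod => p pn.
have := pn; rewrite mem_primes => /andP[/prime_gt0 p0 _].
by rewrite -{1}[p]expn1 leq_pexp2l ?logn_gt0.
Qed.

Lemma chi_dvd {n : nat} : 0 < n -> chi n %| n.
Proof. by move=> n0; apply: dvdn_trans (chi_sqr_dvd n0); rewrite dvdn_exp. Qed.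

(** By Euclid's lemma [p] divides [n %/ chi n] or [chi n]; the second case reduces to the first
    because [chi n] itself divides [n %/ chi n]. *)
Lemma prime_dvd_div_chi (n p : nat) :
  0 < n -> prime p -> p %| n -> p %| n %/ chi n.
Proof.
move=> n0 pp pn; have chi0 : 0 < chi n := dvdn_gt0 n0 (chi_dvd n0).
have chi_dvd_quot : chi n %| n %/ chi n.
  by rewrite dvdn_divRL ?chi_dvd // mulnn chi_sqr_dvd.
move: pn; rewrite -{1}(divnK (chi_dvd n0)) Euclid_dvdM //.
by case/orP => // /dvdn_trans; apply.
Qed.

(** An exponent above 1 would give [p ^ 2 %| n], hence [p <= chi n = 1]. *)
Lemma prod_primes_chi1 {n : nat} :
  0 < n -> chi n = 1 -> \prod_(p <- primes n) p = n.
Proof.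
move=> n0 chi1; rewrite -[RHS]prod_primes_logn // big_seq [RHS]big_seq.
apply: eq_bigr => p pn; have := pn; rewrite mem_primes => /and3P[pp _ _].
suff -> : logn p n = 1 by rewrite expn1.
apply/eqP; rewrite eqn_leq logn_gt0 pn andbT leqNgt -pfactor_dvdn //.
by apply/negP => /(chi_max n0); rewrite chi1 leqNgt prime_gt1.
Qed.

Lemma prime_dvd_fact_le {p r : nat} : prime p -> p %| r`! -> p <= r.
Proof.
move=> pp; elim: r => [|r IHr]; first by rewrite fact0 Euclid_dvd1.
by rewrite factS Euclid_dvdM // => /orP[/dvdn_leq->|/IHr/leqW].
Qed.

Lemma chi1_lt_exp_omega (n r : nat) :
  composite n -> chi n = 1 -> (forall p, p \in primes n -> p <= r) ->
  n < r ^ omega n.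
Proof.
move=> /andP[n1 n_np] chi1; have prodE := prod_primes_chi1 (ltnW n1) chi1.
rewrite -[X in X < _]prodE /omega.
have := sorted_primes n; have : all prime (primes n).
  by apply/allP => p; rewrite mem_primes => /and3P[].
(* An empty list would give [n = 1] and a singleton would make [n] prime, so the list starts with
   two primes [p < q]. *)
case: (primes n) prodE => [|p [|q s]] prodE.
- by move: n1; rewrite -prodE big_nil.
- by move: n_np; rewrite -prodE big_seq1 /= => /negPf->.
move=> _ /= /andP[pq _] le_r; rewrite big_cons expnS.
have qr : q <= r by rewrite le_r // !inE eqxx orbT.
have pr := leq_trans pq qr.
have le_tail : \prod_(j <- q :: s) j <= r ^ size (q :: s).
  by apply: prod_seq_le_exp => x xs; rewrite le_r // inE xs orbT.
(* The tail is bounded only weakly; strictness comes from the head, as [p < q <= r]. *)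
apply: leq_ltn_trans (leq_mul (leqnn p) le_tail) _.
by rewrite ltn_mul2r pr expn_gt0 (leq_ltn_trans _ pr).
Qed.

Theorem theorem7p2 (n : nat) (hn : 1 < n) (hc : composite n) :
  T n %| n /\ 1 < T n /\ T n < n.
Proof.
have n0 := ltnW hn; have om0 := omega_gt0 hn.
have quot_dvd : n %/ chi n %| n.
  by rewrite -[X in _ %| X](divnK (chi_dvd n0)) dvdn_mulr.
have T_dvd : T n %| n := dvdn_trans (dvdn_gcdl _ _) quot_dvd.
have T0 : 0 < T n := dvdn_gt0 n0 T_dvd.
split=> //; split.
  have pp := pdiv_prime hn.
  apply: leq_trans (prime_gt1 pp) (dvdn_leq T0 _).
  rewrite dvdn_gcd prime_dvd_div_chi ?pdiv_dvd //=.
  by rewrite dvdn_fact // pdiv_gt0 floor_root_max // pdiv_exp_omega_le.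
rewrite ltn_neqAle (dvdn_leq n0 T_dvd) andbT; apply/eqP => Tn.
(* A gcd equal to [n] makes [n] divide both arguments: the quotient forces [chi n = 1], and the
   factorial bounds the primes of [n] by the root. *)
have n_dvd_quot : n %| n %/ chi n by rewrite -[X in X %| _]Tn dvdn_gcdl.
have chi1 : chi n = 1.
  have quotE : n %/ chi n = n by apply/eqP; rewrite eqn_dvd quot_dvd.
  have := divnK (chi_dvd n0); rewrite quotE -[RHS]muln1 => /eqP.
  by rewrite eqn_pmul2l // => /eqP.
have n_dvd_fact : n %| (floor_root (omega n) n)`!.
  by rewrite -[X in X %| _]Tn dvdn_gcdr.
have := floor_root_exp_le n om0; rewrite leqNgt chi1_lt_exp_omega // => p.
rewrite mem_primes => /and3P[pp _ pn].
exact: prime_dvd_fact_le pp (dvdn_trans pn n_dvd_fact).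
Qed.
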